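(* Let $m,n\in\mathbb{N}$, $N=m+n$, and $0\le c<\infty$. Then $0\in\operatorname{Spec}(\mathcal{A}_{m,n;c})$ if and only if $$c=2\cos(\pi j/(N+1))$$ for some integer $j$ with $1\le j\le N$; this implies that $0\le c<2$. If $0\notin\operatorname{Spec}(\mathcal{A}_{m,n;c})$ then $$\operatorname{dist}(\operatorname{Spec}(\mathcal{A}_{m,n;c}),0)\ge\delta_{N;c},\qquad\text{where}\qquad \delta_{N;c}:=\min_{1\le j\le N}|c-2\cos(\pi j/(N+1))|.$$
   Context: For $N=m+n$, $H_{N;c}$ is the real symmetric tridiagonal $N\times N$ matrix with entries $c$ on the diagonal, $1$ where $|r-s|=1$, and $0$ otherwise. $D_{m,n}$ is the $N\times N$ diagonal matrix whose first $m$ diagonal entries are $1$ and whose last $n$ diagonal entries are $-1$. The pencil is $\mathcal{A}_{m,n;c}(\lambda)=H_{N;c}-\lambda D_{m,n}$, and its spectrum $\operatorname{Spec}(\mathcal{A}_{m,n;c})$ is the set of $\lambda\in\mathbb{C}$ (the eigenvalues) for which $H_{N;c}-\lambda D_{m,n}$ is not invertible. *)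

(* Defs.v *)
(* MathComp with MathComp-Analysis; complex numbers are R[i] over R : realType. *)
From HB Require Import structures.
From mathcomp Require Import all_boot all_order all_algebra.
From mathcomp Require Import all_classical all_reals all_analysis.
From mathcomp Require Import complex.

Set Implicit Arguments.
Unset Strict Implicit.
Unset Printing Implicit Defensive.

Import Order.TTheory GRing.Theory Num.Theory.

Local Open Scope classical_set_scope.
Local Open Scope ring_scope.
Local Open Scope complex_scope.

(* Matrix indices start at 0. *)
Definition Hmx (R : realType) (N : nat) (c : R) : 'M[R]_N :=
  \matrix_(r < N, s < N)
    (if r == s then c
     else if (r.+1 == s :> nat) || (s.+1 == r :> nat) then 1 else 0).

Definition Dmx (R : realType) (m n : nat) : 'M[R]_(m + n) :=
  \matrix_(r < m + n, s < m + n)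
    (if r == s then (if (r < m)%N then 1 else -1) else 0).

Definition pencil (R : realType) (m n : nat) (c : R) (lambda : R[i]) :
    'M[R[i]]_(m + n) :=
  map_mx (real_complex R) (Hmx (m + n) c)
  - lambda *: map_mx (real_complex R) (Dmx R m n).

Definition Spec (R : realType) (m n : nat) (c : R) : set R[i] :=
  [set lambda : R[i] | pencil m n c lambda \notin unitmx].

(* [normc] is the R-valued modulus on R[i].  The infimum is taken in R, so it
   is 0 when [S] is empty. *)
Definition dist (R : realType) (S : set R[i]) (z : R[i]) : R :=
  inf [set Normc.normc (w - z) | w in S].

(* The default value of the iterated minimum is its term at j = 1, so for
   N >= 1 it is the minimum over 1 <= j <= N. *)
Definition delta (R : realType) (N : nat) (c : R) : R :=
  \big[Num.min/ `|c - 2 * cos (pi * 1%:R / N.+1%:R)|]_(1 <= j < N.+1)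
    `|c - 2 * cos (pi * j%:R / N.+1%:R)|.

(* Main.v *)
(* The matrix H is symmetric with the orthogonal eigenbasis
   (-1)^r sin(r theta_j), theta_j = pi j / (N + 1), 1 <= j <= N, and simple
   eigenvalues c - 2 cos theta_j.  Hence det H is the product of these
   eigenvalues, which settles when 0 is in the spectrum, and
   |v H| >= delta |v| for every complex row vector v.  If v H = lambda v D with
   v <> 0, then |lambda| |v| = |v H| >= delta |v| because D is unitary.  The
   spectrum is nonempty since D^2 = 1 identifies it with that of H D. *)
Require Import Defs.
From HB Require Import structures.
From mathcomp Require Import all_boot all_order all_algebra.
From mathcomp Require Import all_classical all_reals all_analysis.
From mathcomp Require Import complex ring lra.

Set Implicit Arguments.
Unset Strict Implicit.
Unset Printing Implicit Defensive.

Import Order.TTheory GRing.Theory Num.Theory.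

Local Open Scope classical_set_scope.
Local Open Scope ring_scope.
Local Open Scope complex_scope.

(** * Sine eigenvectors and the determinant of [Hmx] *)

Definition Hmx_eigenval (R : realType) (N : nat) (c : R) (j : nat) : R :=
  c - 2 * cos (pi * j.+1%:R / N.+1%:R).

(* The sign (-1)^r makes row j an eigenvector for c - 2 cos(theta_j) rather than
   c + 2 cos(theta_j), which matches the indexing of [delta]. *)
Definition sinemx (R : realType) (N : nat) : 'M[R]_N :=
  \matrix_(j < N, r < N) ((-1) ^+ r * sin (r.+1%:R * (pi * j.+1%:R / N.+1%:R))).

Lemma angle_in0pi (R : realType) (N j : nat) : (j < N)%N ->
  0 < (pi : R) * j.+1%:R / N.+1%:R < pi.
Proof.
move=> jN; have p0 := pi_gt0 R.
rewrite divr_gt0 ?mulr_gt0 ?ltr0n//= ltr_pdivrMr ?ltr0n//.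
by rewrite ltr_pM2l// ltr_nat ltnS.
Qed.

(** Cosine is injective on [[0, pi]], which contains all the angles. This simplicity of the
    eigenvalues is what makes the sine rows orthogonal. *)
Lemma Hmx_eigenval_inj (R : realType) (N : nat) (c : R) (i j : 'I_N) :
  Hmx_eigenval N c i = Hmx_eigenval N c j -> i = j.
Proof.
have /andP[i0 ip] := angle_in0pi R (ltn_ord i).
have /andP[j0 jp] := angle_in0pi R (ltn_ord j).
rewrite /Hmx_eigenval => e; have {e} : cos (pi * i.+1%:R / N.+1%:R)
  = cos (pi * j.+1%:R / N.+1%:R) :> R by lra.
move/cos_inj; rewrite !in_itv/= !ltW// => /(_ isT isT).
move/(mulIf (invr_neq0 (lt0r_neq0 (ltr0Sn R N)))).
move/(mulfI (lt0r_neq0 (pi_gt0 R)))/eqP.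
by rewrite eqr_nat eqSS => /eqP/val_inj.
Qed.

Lemma Hmx_tr (R : realType) (N : nat) (c : R) : (Hmx N c)^T = Hmx N c.
Proof. by apply/matrixP => i j; rewrite !mxE eq_sym orbC. Qed.

(** Entry [k] of the vector is [f k.+1]; the zeros of [f] at [0] and [N.+1] let the first and last
    columns obey the interior three-term formula. *)
Lemma sum_Hmx (R : realType) (N : nat) (c : R) (f : nat -> R) (r : 'I_N) :
  f 0 = 0 -> f N.+1 = 0 ->
  \sum_(k < N) f k.+1 * Hmx N c k r = f r + c * f r.+1 + f r.+2.
Proof.
move=> f0 fN.
have sum1 (p : nat) : \sum_(k < N) f k.+1 * (k.+1 == p)%:R
    = if (0 < p <= N)%N then f p else 0.
  case: ifPn => [|pN]; last first.
    rewrite big1// => k _; case: eqP => [kp|]; last by rewrite mulr0.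
    by case/negP: pN; rewrite -kp/=.
  case: p => // p /= pN; rewrite (bigD1 (Ordinal pN))//= eqxx mulr1.
  rewrite big1 ?addr0// => k kp; rewrite eqSS; case: eqP => [e|]; last by rewrite mulr0.
  by case/eqP: kp; apply: val_inj.
transitivity (\sum_(k < N) (f k.+1 * (k.+1 == r :> nat)%:R
    + c * (f k.+1 * (k.+1 == r.+1)%:R) + f k.+1 * (k.+1 == r.+2)%:R)).
  apply: eq_bigr => k _; rewrite mxE -val_eqE/= !eqSS [r.+1 == _]eq_sym.
  have [->|/eqP kr] := altP (val k =P r).
    by rewrite (gtn_eqF (ltnSn r)) (ltn_eqF (ltnSn r)) /=; ring.
  have [kr1|kr1] := altP (k.+1 =P r).
    by rewrite -kr1 (ltn_eqF (ltnW (ltnSn k.+1))) /=; ring.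
  by case: eqP => _ /=; ring.
rewrite !big_split/= -big_distrr/= !sum1/=.
have rN := ltn_ord r; rewrite rN (ltnW rN) andbT.
congr (_ + _ + _); first by case: ltnP => //; rewrite leqn0 => /eqP->.
by case: ltnP => // Nr; rewrite (_ : r.+2 = N.+1)//; congr _.+1; apply/eqP; rewrite eqn_leq rN.
Qed.

Lemma sinemx_Hmx (R : realType) (N : nat) (c : R) :
  sinemx R N *m Hmx N c = diag_mx (\row_j Hmx_eigenval N c j) *m sinemx R N.
Proof.
apply/matrixP => j r; rewrite mul_diag_mx !mxE.
set t : R := pi * j.+1%:R / N.+1%:R.
(* The leading minus absorbs the index shift: [f k.+1] is the entry of [sinemx] in column [k]. *)
pose f k : R := - (-1) ^+ k * sin (k%:R * t).
rewrite (eq_bigr (fun k : 'I_N => f k.+1 * Hmx N c k r)); last first.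
  by move=> k _; rewrite [in LHS]mxE -/t /f exprS !mulN1r opprK.
rewrite sum_Hmx /f.
- rewrite !exprS !(mulN1r, opprK) /Hmx_eigenval -/t.
  have -> : r.+2%:R * t = r.+1%:R * t + t by rewrite -[in LHS]natr1 mulrDl mul1r.
  have -> : r%:R * t = r.+1%:R * t - t by rewrite -[in RHS]natr1; ring.
  by rewrite sinB sinD; ring.
- by rewrite mulr0n mul0r sin0 mulr0.
(* The right boundary value vanishes because (N+1)t is a multiple of pi. *)
have -> : N.+1%:R * t = j.+1%:R * pi.
  by rewrite /t mulrC divfK ?pnatr_eq0 1?mulrC.
suff -> : sin (j.+1%:R * pi) = 0 :> R by rewrite mulr0.
elim: j.+1 => [|k IH]; first by rewrite mulr0n mul0r sin0.
by rewrite -natr1 mulrDl mul1r sinDpi IH oppr0.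
Qed.

(* Both S and S^T intertwine the symmetric H with its eigenvalues, so S S^T
   commutes with a diagonal matrix whose entries are distinct. *)
Lemma sinemx_gram_diag (R : realType) (N : nat) (i j : 'I_N) : i != j ->
  (sinemx R N *m (sinemx R N)^T) i j = 0.
Proof.
set S := sinemx R N => ij.
have /matrixP/(_ i j) : S *m S^T *m diag_mx (\row_j Hmx_eigenval N 0 j)
    = diag_mx (\row_j Hmx_eigenval N 0 j) *m (S *m S^T).
  rewrite [RHS]mulmxA -sinemx_Hmx -mulmxA.
  rewrite -[diag_mx _]trmxK tr_diag_mx -trmx_mul -sinemx_Hmx trmx_mul Hmx_tr.
  by rewrite !mulmxA.
rewrite mul_mx_diag mul_diag_mx.
rewrite ![X in _ = X -> _]mxE [(\row_j _) _ _]mxE [X in X = _ -> _]mxE [(\row_j _) _ _]mxE.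
move=> /eqP; rewrite mulrC -subr_eq0 -mulrBl mulf_eq0 => /orP[|/eqP//].
by rewrite subr_eq0 => /eqP/Hmx_eigenval_inj ji; rewrite ji eqxx in ij.
Qed.

Lemma sinemx_gram_gt0 (R : realType) (N : nat) (j : 'I_N) :
  0 < (sinemx R N *m (sinemx R N)^T) j j.
Proof.
rewrite mxE; case: N j => [[]//|N] j.
(* The first term is the square of sin(theta) with theta strictly inside (0, pi); the remaining
   terms are squares. *)
rewrite big_ord_recl ltr_pwDl//; last first.
  by apply: sumr_ge0 => i _; rewrite [_^T _ _]mxE -expr2 sqr_ge0.
by rewrite !mxE !expr0 !mul1r mulr_gt0// sin_gt0_pi// angle_in0pi.
Qed.

(** The sine rows are left unnormalised; their squared lengths [d] serve as positive weights in the
    norm estimate. *)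
Lemma sinemx_gram (R : realType) (N : nat) :
  exists2 d : 'rV[R]_N, (forall j, 0 < d 0 j)
    & sinemx R N *m (sinemx R N)^T = diag_mx d.
Proof.
exists (\row_j (sinemx R N *m (sinemx R N)^T) j j).
  by move=> j; rewrite mxE sinemx_gram_gt0.
apply/matrixP => i j; rewrite [RHS]mxE [(\row_j _) _ _]mxE.
have [->|ij] := eqVneq i j; first by rewrite mulr1n.
by rewrite mulr0n sinemx_gram_diag.
Qed.

Lemma sinemx_unit (R : realType) (N : nat) : sinemx R N \in unitmx.
Proof.
have [d d0 dE] := sinemx_gram R N.
have : \det (sinemx R N *m (sinemx R N)^T) != 0.
  by rewrite dE det_diag; apply/prodf_neq0 => j _; rewrite gt_eqF.
by rewrite det_mulmx mulf_eq0 negb_or unitmxE unitfE => /andP[].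
Qed.

Lemma det_Hmx (R : realType) (N : nat) (c : R) :
  \det (Hmx N c) = \prod_(j < N) Hmx_eigenval N c j.
Proof.
have Su := sinemx_unit R N; rewrite unitmxE unitfE in Su.
apply: (mulfI Su); rewrite -det_mulmx sinemx_Hmx det_mulmx det_diag mulrC.
by congr (_ * _); apply: eq_bigr => j _; rewrite mxE.
Qed.

(** * The bound |v H| >= delta |v|, first for real, then for complex vectors *)

Lemma delta_le (R : realType) (N : nat) (c : R) (j : 'I_N) :
  delta N c <= `|Hmx_eigenval N c j|.
Proof.
rewrite /delta /Hmx_eigenval; apply: (@ge_bigmin_seq _ _ _ _ _ j.+1 xpredT
  (fun k => `|c - 2 * cos (pi * k%:R / N.+1%:R)|)) => //.
by rewrite mem_index_iota/= ltnS.
Qed.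

Lemma delta_ge0 (R : realType) (N : nat) (c : R) : 0 <= delta N c.
Proof.
rewrite /delta; elim/big_ind: _ => // x y x0 y0.
by rewrite le_min x0.
Qed.

(** In the coordinates [w] of [u] along the sine rows, both sides are sums weighted by [d], and
    [Hmx] multiplies each coordinate by its eigenvalue; the terms are compared one by one. *)
Lemma Hmx_norm_ge (R : realType) (N : nat) (c : R) (u : 'rV[R]_N) :
  delta N c ^+ 2 * \sum_i u 0 i ^+ 2 <= \sum_i (u *m Hmx N c) 0 i ^+ 2.
Proof.
have normE (x : 'rV[R]_N) : \sum_i x 0 i ^+ 2 = (x *m x^T) 0 0.
  by rewrite mxE; apply: eq_bigr => i _; rewrite mxE expr2.
have [d d0 dE] := sinemx_gram R N.
have normS (w : 'rV[R]_N) :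
    ((w *m sinemx R N) *m (w *m sinemx R N)^T) 0 0 = \sum_i d 0 i * w 0 i ^+ 2.
  rewrite trmx_mul mulmxA -(mulmxA w) dE mul_mx_diag mxE.
  by apply: eq_bigr => i _; rewrite !mxE; ring.
rewrite !normE -[u](mulmxKV (sinemx_unit R N)).
set w := u *m _.
rewrite normS -(mulmxA w) sinemx_Hmx (mulmxA w) normS mulr_sumr.
apply: ler_sum => i _; rewrite mul_mx_diag !mxE exprMn mulrCA.
apply: ler_wpM2l; first exact: ltW.
rewrite mulrC; apply: ler_wpM2l; first exact: sqr_ge0.
by rewrite -[leRHS]real_normK ?num_real// ler_sqr ?nnegrE ?delta_ge0// delta_le.
Qed.

Lemma Re_mulmx (R : realType) (N : nat) (v : 'rV[R[i]]_N) (A : 'M[R]_N) :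
  map_mx (@complex.Re R) (v *m map_mx (real_complex R) A)
  = map_mx (@complex.Re R) v *m A.
Proof.
apply/matrixP => i j; rewrite !mxE.
rewrite (big_morph (@complex.Re R) (id1 := 0) (op1 := +%R))//; last by case=> ? ? [].
by apply: eq_bigr => k _; rewrite !mxE; case: (v _ _) => a b /=; ring.
Qed.

Lemma Im_mulmx (R : realType) (N : nat) (v : 'rV[R[i]]_N) (A : 'M[R]_N) :
  map_mx (@complex.Im R) (v *m map_mx (real_complex R) A)
  = map_mx (@complex.Im R) v *m A.
Proof.
apply/matrixP => i j; rewrite !mxE.
rewrite (big_morph (@complex.Im R) (id1 := 0) (op1 := +%R))//; last by case=> ? ? [].
by apply: eq_bigr => k _; rewrite !mxE; case: (v _ _) => a b /=; ring.
Qed.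

Lemma sqr_normc_ReIm (R : realType) (z : R[i]) :
  Normc.normc z ^+ 2 = complex.Re z ^+ 2 + complex.Im z ^+ 2.
Proof. by case: z => a b /=; rewrite sqr_sqrtr// addr_ge0 ?sqr_ge0. Qed.

(** Since [Hmx] is real, it acts separately on real and imaginary parts, whose squared norms add
    up. *)
Lemma Hmx_normc_ge (R : realType) (N : nat) (c : R) (v : 'rV[R[i]]_N) :
  delta N c ^+ 2 * \sum_i Normc.normc (v 0 i) ^+ 2
  <= \sum_i Normc.normc ((v *m map_mx (real_complex R) (Hmx N c)) 0 i) ^+ 2.
Proof.
have splitE (x : 'rV[R[i]]_N) : \sum_i Normc.normc (x 0 i) ^+ 2
   = \sum_i (map_mx (@complex.Re R) x) 0 i ^+ 2
     + \sum_i (map_mx (@complex.Im R) x) 0 i ^+ 2.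
  rewrite -big_split; apply: eq_bigr => i _.
  by rewrite sqr_normc_ReIm ![map_mx _ x _ _]mxE.
by rewrite !splitE Re_mulmx Im_mulmx mulrDr lerD// Hmx_norm_ge.
Qed.

(** * The sign matrix and the spectrum of the pencil *)

Lemma Dmx_normc (R : realType) (m n : nat) (v : 'rV[R[i]]_(m + n)) i :
  Normc.normc ((v *m map_mx (real_complex R) (Dmx R m n)) 0 i)
  = Normc.normc (v 0 i).
Proof.
rewrite mxE (bigD1 i)//= big1 ?addr0 => [|k ki].
  rewrite !mxE eqxx Normc.normcM; case: ifP => _ /=.
    by rewrite expr0n/= expr1n addr0 sqrtr1 mulr1.
  by rewrite expr0n/= sqrrN expr1n addr0 sqrtr1 mulr1.
by rewrite !mxE (negbTE ki) rmorph0 mulr0.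
Qed.

Lemma Dmx_sqr (R : realType) (m n : nat) : Dmx R m n *m Dmx R m n = 1%:M.
Proof.
have -> : Dmx R m n = diag_mx (\row_(i < m + n) (if (i < m)%N then 1 else -1)).
  apply/matrixP => i j; rewrite !mxE; have [->|] := eqVneq i j; by rewrite ?mulr1n ?mulr0n.
rewrite mulmx_diag; apply/matrixP => i j; rewrite !mxE.
by congr (_ *+ _); case: ifP => _; rewrite ?mulrNN mulr1.
Qed.

Lemma SpecP (R : realType) (m n : nat) (c : R) (z : R[i]) :
  Spec m n c z <-> exists2 v : 'rV[R[i]]_(m + n), v != 0
    & v *m map_mx (real_complex R) (Hmx (m + n) c)
      = z *: (v *m map_mx (real_complex R) (Dmx R m n)).
Proof.
rewrite /Spec/= unitmxE unitfE negbK; split.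
  move/det0P => [v v0]; rewrite /pencil mulmxBr -scalemxAr => /eqP.
  by rewrite subr_eq0 => /eqP e; exists v.
move=> [v v0 e]; apply/det0P; exists v => //.
by rewrite /pencil mulmxBr -scalemxAr e subrr.
Qed.

Lemma Spec0E (R : realType) (m n : nat) (c : R) :
  Spec m n c 0 <-> exists j : 'I_(m + n), Hmx_eigenval (m + n) c j = 0.
Proof.
rewrite /Spec/= /pencil scale0r subr0 unitmxE unitfE negbK det_map_mx.
rewrite fmorph_eq0 det_Hmx; split.
  by move/prodf_eq0 => [j _ /eqP e]; exists j.
by move=> [j e]; apply/prodf_eq0; exists j => //; rewrite e.
Qed.

(** Needed to bound [dist] below, as [inf] of the empty set is 0. An eigenvector of H D exists over
    the algebraically closed [R[i]]; multiplying v H D = z v by D on the right gives v H = z v D. *)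
Lemma Spec_nonempty (R : realType) (m n : nat) (c : R) : (0 < m + n)%N ->
  Spec m n c !=set0.
Proof.
move=> N0; set H := map_mx (real_complex R) (Hmx (m + n) c).
set D := map_mx (real_complex R) (Dmx R m n).
have [z /eigenvalueP[v vE v0]] := eigenvalue_closed (H *m D) N0.
exists z; apply/SpecP; exists v => //; rewrite -/H -/D.
have DD : D *m D = 1%:M by rewrite -map_mxM Dmx_sqr map_mx1.
by rewrite -[LHS]mulmx1 -DD !mulmxA -(mulmxA v) vE scalemxAl.
Qed.

Lemma delta_le_normc_Spec (R : realType) (m n : nat) (c : R) (z : R[i]) :
  Spec m n c z -> delta (m + n) c <= Normc.normc z.
Proof.
move=> /SpecP[v v0 vE].
have z0 : 0 <= Normc.normc z by case: (z) => a b /=; rewrite sqrtr_ge0.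
rewrite -ler_sqr ?nnegrE ?delta_ge0//.
have := Hmx_normc_ge c v; rewrite vE.
under [leRHS]eq_bigr do rewrite mxE Normc.normcM Dmx_normc exprMn.
(* Both sides carry the factor |v|^2, which cancels once it is shown positive: its vanishing would
   force every entry of [v] to be 0. *)
rewrite -mulr_sumr ler_pM2r// lt_neqAle eq_sym sumr_ge0 ?andbT => [|i _]; last exact: sqr_ge0.
apply: contra v0 => /eqP v0; apply/eqP/rowP => i; rewrite mxE.
apply: Normc.eq0_normc; apply/eqP; rewrite -sqrf_eq0; apply/eqP.
exact: (psumr_eq0P (fun i _ => sqr_ge0 (Normc.normc (v 0 i))) v0).
Qed.

Theorem theorem7p1 (R : realType) (m n : nat) (c : R)
    (m_gt0 : (0 < m)%N) (n_gt0 : (0 < n)%N) (c_ge0 : 0 <= c) :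
  [/\ Spec m n c 0 <->
        (exists j : nat, (1 <= j <= m + n)%N /\
           c = 2 * cos (pi * j%:R / (m + n).+1%:R)),
      Spec m n c 0 -> 0 <= c < 2
    & ~ Spec m n c 0 -> delta (m + n) c <= dist (Spec m n c) 0].
Proof.
have Spec0P : Spec m n c 0 <->
    (exists j : nat, (1 <= j <= m + n)%N /\
       c = 2 * cos (pi * j%:R / (m + n).+1%:R)).
  rewrite Spec0E; split=> [[j /subr0_eq cE]|[[|j] [/andP[j1 jN] cE]]] //.
    by exists j.+1; rewrite ltn_ord.
  by exists (Ordinal jN); rewrite /Hmx_eigenval/= -cE subrr.
split=> //.
  move=> /Spec0P[[|j] [/andP[j1 jN] cE]] //; rewrite c_ge0/= cE.
  have /andP[t0 tpi] := angle_in0pi R jN.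
  (* The angle is positive and cosine strictly decreases on [[0, pi]], hence the strict bound
     [c < 2]. *)
  have : cos (pi * j.+1%:R / (m + n).+1%:R) < cos 0 :> R.
    by rewrite ltr_cos ?in_itv/= ?lexx ?pi_ge0 ?(ltW t0) ?(ltW tpi).
  by rewrite cos0; lra.
move=> _; apply: lb_le_inf.
  have [z Sz] := @Spec_nonempty R m n c (ltn_addr n m_gt0).
  by exists (Normc.normc (z - 0)), z.
by move=> _ [z Sz <-]; rewrite subr0; exact: delta_le_normc_Spec.
Qed.
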